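(* Let $(x_k)_{k\ge1}\subset M$ be a sequence generated by the Riemannian adaptive scheme (described in the context). Suppose: (A1) $\mathbb{E}_k[\operatorname{grad} f_{s_{k,i}}(x_k)]=\operatorname{grad} f(x_k)$ for all $k\ge1$ and $i=1,\dots,b_k$; (A2) there is $\sigma^2>0$ with $\mathbb{E}_k[\|\operatorname{grad} f_{s_{k,i}}(x_k)-\operatorname{grad} f(x_k)\|_2^2]\le\sigma^2$ for all $k\ge1$ and $i=1,\dots,b_k$; (A3) there are $G,B>0$ with $\|\operatorname{grad} f(x_k)\|_2\le G$ and $\|\operatorname{grad} f_{B_k}(x_k)\|_2\le B$ for all $k\ge1$; (A4) there is $L>0$ with $|\mathrm{D}(f\circ R_x)(\eta)[\eta]-\mathrm{D}f(x)[\eta]|\le L\|\eta\|_2^2$ for all $x\in M$, $\eta\in T_xM$; (A5) $f$ is bounded below by $f_\star\in\mathbb{R}$. Assume moreover that, for all $k\ge1$, $\alpha_{k+1}\le\alpha_k$, $\phi_k(g_1,\dots,g_k)=g_k$ and $\alpha_kH_k^{-1}\succeq\alpha_{k+1}H_{k+1}^{-1}$, and that there exist $\mu,\nu>0$ such that $\mu I_d\preceq H_k^{-1}\preceq\nu I_d$ for all $k\ge1$. Then $$\sum_{k=1}^K\alpha_k\left(\mu-\frac{L\alpha_k\nu^2}{2}\right)\mathbb{E}\left[\|\operatorname{grad} f(x_k)\|_2^2\right]\le C_1+C_2\sum_{k=1}^K\frac{\alpha_k^2}{b_k}$$ for some constants $C_1,C_2>0$ (not depending on $K$).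
   Context: Geometry. $M$ is an embedded submanifold of $\mathbb{R}^d$ with the Riemannian metric induced by $\langle x,y\rangle_2=x^\top y$ (norm $\|\cdot\|_2$); each tangent space $T_xM$ is regarded as a linear subspace of $\mathbb{R}^d$, and $P_x:\mathbb{R}^d\to T_xM$ is the orthogonal projection. $\operatorname{grad}$ is the Riemannian gradient: $\langle\operatorname{grad} f(x),\eta\rangle_2=\mathrm{D}f(x)[\eta]$ for all $\eta\in T_xM$. A retraction is a smooth map $R:TM\to M$ whose restriction $R_x$ to $T_xM$ satisfies $R_x(0_x)=x$ and $\mathrm{D}R_x(0_x)=\mathrm{id}_{T_xM}$ for all $x\in M$. $X\preceq Y$ (equivalently $Y\succeq X$) means $Y-X$ is positive semidefinite; $I_d$ is the $d\times d$ identity matrix. Problem and sampling. $f:M\to\mathbb{R}$, $f=\frac1N\sum_{i=1}^N f_i$ with $f_i:M\to\mathbb{R}$ smooth. $b_k$ ($\le N$) is the batch size at iteration $k$. $s_{k,i}$ is the random variable (an index in $\{1,\dots,N\}$) generated from the $i$-th sampling at the $k$-th iteration, and $\boldsymbol{s}_k=(s_{k,1},\dots,s_{k,b_k})^\top$. The vectors $\boldsymbol{s}_1,\boldsymbol{s}_2,\dots$ are independent, and $\boldsymbol{s}_k$ is independent of the iterates $x_1,\dots,x_k$. $\mathbb{E}_k$ denotes expectation with respect to $\boldsymbol{s}_k$, and the total expectation $\mathbb{E}$ is $\mathbb{E}_1\mathbb{E}_2\cdots\mathbb{E}_k$. The mini-batch gradient is $\operatorname{grad} f_{B_k}(x_k)=\frac1{b_k}\sum_{i=1}^{b_k}\operatorname{grad}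 f_{s_{k,i}}(x_k)$. Riemannian adaptive scheme. Given an initial point $x_1\in M$, a retraction $R$, step sizes $\alpha_k>0$, and maps $\phi_k:T_{x_1}M\times\cdots\times T_{x_k}M\to\mathbb{R}^d$ and $\psi_k$ from $T_{x_1}M\times\cdots\times T_{x_k}M$ to the diagonal positive definite $d\times d$ matrices, for $k=1,2,\dots$: $g_k=\operatorname{grad} f_{B_k}(x_k)$, $m_k=\phi_k(g_1,\dots,g_k)$, $H_k=\psi_k(g_1,\dots,g_k)$, $x_{k+1}=R_{x_k}(-\alpha_kP_{x_k}(H_k^{-1}m_k))$. *)

(* Defs.v *)
From HB Require Import structures.
From mathcomp Require Import all_boot all_order all_algebra.
From mathcomp Require Import all_classical all_reals all_analysis.
Set Implicit Arguments.
Unset Strict Implicit.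
Unset Printing Implicit Defensive.
Import Order.TTheory GRing.Theory Num.Theory.
Import numFieldNormedType.Exports.
Local Open Scope classical_set_scope.
Local Open Scope ring_scope.

Section Euclidean.
Context {R : realType} {d : nat}.

(* The canonical norm `|x| of 'cV[R]_d is the sup norm; it is used only for the
   topology, and metric statements go through [norm2]. *)
Definition dot (u v : 'cV[R]_d) : R := (u^T *m v) 0 0.
Definition norm2 (u : 'cV[R]_d) : R := Num.sqrt (dot u u).

Definition oproj (V : set 'cV[R]_d) (u : 'cV[R]_d) : 'cV[R]_d :=
  xget 0 [set p | V p /\ forall v, V v -> dot (u - p) v = 0].

Definition psd (A : 'M[R]_d) : Prop :=
  A^T = A /\ forall v : 'cV[R]_d, 0 <= dot v (A *m v).
Definition posdef (A : 'M[R]_d) : Prop :=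
  A^T = A /\ forall v : 'cV[R]_d, v != 0 -> 0 < dot v (A *m v).
Definition loewner_le (X Y : 'M[R]_d) : Prop := psd (Y - X).

End Euclidean.

Section Smooth.
Context {R : realType} {V W : normedModType R}.

(* Class C^n on an open set U of a finite-dimensional space V, where iterated
   directional derivatives determine all the higher differentials. *)
Fixpoint Cn (n : nat) (U : set V) (f : V -> W) : Prop :=
  if n is n'.+1 then
    (forall x, U x -> differentiable f x) /\ (forall v, Cn n' U ('D_v f))
  else forall x, U x -> {for x, continuous f}.

Definition smooth (U : set V) (f : V -> W) : Prop := forall n, Cn n U f.

(* Maps defined on a subset S of V are total functions whose values outside S
   are never used; smoothness is local extendability. *)
Definition smooth_on (S : set V) (f : V -> W) : Prop :=
  forall x, S x -> exists (U : set V) (g : V -> W),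
    [/\ open U, U x, smooth U g & forall y, S y -> U y -> f y = g y].

End Smooth.

Section Submanifold.
Context {R : realType} {d : nat}.
Implicit Types (M : set 'cV[R]_d) (x v : 'cV[R]_d).

(* Slice charts: around each point, a diffeomorphism F (with inverse F') between
   open sets of R^d straightens M onto the first m coordinates. *)
Definition embedded_submanifold M : Prop :=
  exists2 m : nat, (m <= d)%N & forall x, M x ->
    exists (U : set 'cV[R]_d) (F F' : 'cV[R]_d -> 'cV[R]_d),
      [/\ open U /\ U x, open (F @` U), smooth U F /\ smooth (F @` U) F',
          (forall y, U y -> F' (F y) = y) &
          forall y, U y ->
            (M y <-> forall i : 'I_d, (m <= i)%N -> F y i 0 = 0)].

Definition curve_at M x v (c : R -> 'cV[R]_d) : Prop :=
  c 0 = x /\ is_derive (0 : R) 1 c v /\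
  exists2 e : R, 0 < e &
    smooth (ball (0 : R) e) c /\ forall t, ball (0 : R) e t -> M (c t).

Definition tangent M x : set 'cV[R]_d := [set v | exists c, curve_at M x v c].

Definition tangent_bundle M : set ('cV[R]_d * 'cV[R]_d) :=
  [set p | M p.1 /\ tangent M p.1 p.2].

(* D f(x)[v] for f : M -> W smooth and v tangent to M at x: the derivative at 0
   of f along any curve in M with velocity v. With M := tangent M x, a linear
   subspace, it also gives the differential of maps defined on tangent spaces. *)
Definition Dmap (W : normedModType R) M (f : 'cV[R]_d -> W) x v : W :=
  xget 0 [set w | exists2 c, curve_at M x v c & is_derive (0 : R) 1 (f \o c) w].

Definition rgrad M (f : 'cV[R]_d -> R) x : 'cV[R]_d :=
  xget 0 [set g | tangent M x g /\
                  forall eta, tangent M x eta -> dot g eta = Dmap M f x eta].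

Definition retraction M (r : 'cV[R]_d * 'cV[R]_d -> 'cV[R]_d) : Prop :=
  [/\ smooth_on (tangent_bundle M) r,
      (forall p, tangent_bundle M p -> M (r p)),
      (forall x, M x -> r (x, 0) = x) &
      forall x, M x -> forall eta, tangent M x eta ->
        Dmap (tangent M x) (fun v => r (x, v)) 0 eta = eta].

End Submanifold.

Section Probability.
Context {disp : measure_display} {Om : measurableType disp} {R : realType}.
Variable P : probability Om R.

(* Random elements of countable types carry the discrete sigma-algebra. *)
Definition discrete_rv (T : countType) (X : Om -> T) : Prop :=
  forall A : set T, measurable (X @^-1` A).

Definition mutually_independent (D : set nat) (T : nat -> countType)
    (X : forall k, Om -> T k) : Prop :=
  forall (J : seq nat) (A : forall k, set (T k)),
    uniq J -> (forall k, k \in J -> D k) ->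
    P (\bigcap_(k in [set` J]) (X k @^-1` A k)) =
    (\prod_(k <- J) fine (P (X k @^-1` A k)))%:E.

(* sigma(x_k : k in D) *)
Definition sigma_of (d : nat) (D : set nat) (x : nat -> Om -> 'cV[R]_d) :
    set (set Om) :=
  <<s [set E | exists k (O : set 'cV[R]_d),
                 [/\ D k, open O & E = x k @^-1` O]] >>.

Definition independent_of (T : countType) (X : Om -> T) (F : set (set Om)) :
    Prop :=
  forall (A : set T) (E : set Om), F E ->
    P (X @^-1` A `&` E) = (P (X @^-1` A) * P E)%E.

Definition vexpectation (d : nat) (X : Om -> 'cV[R]_d) : 'cV[R]_d :=
  \col_j fine 'E_P[fun w => X w j 0].

End Probability.

Section Scheme.
Context {R : realType} {d N : nat} {Om : Type}.
Variables (M : set 'cV[R]_d) (f : 'I_N -> 'cV[R]_d -> R).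
Variables (b : nat -> nat) (s : forall k, Om -> (b k).-tuple 'I_N).
Arguments s : clear implicits.

Definition mean_fun (x : 'cV[R]_d) : R := N%:R^-1 * \sum_(i < N) f i x.

(* Iterations are numbered from 1; index 0 of every sequence is junk. *)
Variable x : nat -> Om -> 'cV[R]_d.

Definition batch_grad (k : nat) (w : Om) : 'cV[R]_d :=
  (b k)%:R^-1 *: \sum_(i < b k) rgrad M (f (tnth (s k w) i)) (x k w).

(* ((x_1, g_1), .., (x_k, g_k)): an element of T_{x_1}M x .. x T_{x_k}M, each
   tangent vector being paired with its base point. *)
Definition history (k : nat) (w : Om) : k.-tuple ('cV[R]_d * 'cV[R]_d) :=
  [tuple (x j.+1 w, batch_grad j.+1 w) | j < k].

Variable phi : forall k, k.-tuple ('cV[R]_d * 'cV[R]_d) -> 'cV[R]_d.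
Variable psi : forall k, k.-tuple ('cV[R]_d * 'cV[R]_d) -> 'M[R]_d.

Definition momentum (k : nat) (w : Om) : 'cV[R]_d := phi (history k w).
Definition precond (k : nat) (w : Om) : 'M[R]_d := psi (history k w).

Definition generated (x1 : 'cV[R]_d) (r : 'cV[R]_d * 'cV[R]_d -> 'cV[R]_d)
    (alpha : nat -> R) : Prop :=
  (forall w, x 1%N w = x1) /\
  forall k w, (0 < k)%N ->
    x k.+1 w =
    r (x k w, - alpha k *:
         oproj (tangent M (x k w)) (invmx (precond k w) *m momentum k w)).

End Scheme.

(* Main.v *)
Require Import Defs.
From HB Require Import structures.
From mathcomp Require Import all_boot all_order all_algebra.
From mathcomp Require Import all_classical all_reals all_analysis.
From mathcomp Require Import ring lra.
Set Implicit Arguments.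
Unset Strict Implicit.
Unset Printing Implicit Defensive.
Import Order.TTheory GRing.Theory Num.Theory.
Import numFieldNormedType.Exports.
Local Open Scope classical_set_scope.
Local Open Scope ring_scope.

(* Along the iterations, put W_k = alpha_k H_k^-1, W_0 = alpha_1 nu I and
   C = (G^2 + B^2) / 2. Integrating (A4) along t |-> R_x(t eta) gives the descent
   inequality with constant L / 2. In it W_k, which depends on the current
   sample, is replaced by W_{k-1}, which does not: as S = W_{k-1} - W_k is
   positive semidefinite, |<u, S v>| <= tr S (|u|^2 + |v|^2) / 2, so the
   replacement costs at most C (tr W_{k-1} - tr W_k), which telescopes. By
   independence and (A1), E <grad f(x_k), W_{k-1} g_k> equals
   E <grad f(x_k), W_{k-1} grad f(x_k)> >= alpha_k mu E |grad f(x_k)|^2.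
   The second-order term is at most L nu^2 B^2 alpha_k^2 / 2, and 1 <= N / b_k.
   All the random variables at step k are functions of the finite-valued vector
   (s_1, .., s_k), so that expectations are finite sums. *)

(** * Inner products, semidefinite matrices, orthogonal projections *)

Section LinearAlgebra.
Context {R : realType} {d : nat}.
Implicit Types (u v w : 'cV[R]_d) (S T : 'M[R]_d) (V : set 'cV[R]_d).

Lemma dotE u v : dot u v = \sum_i u i 0 * v i 0.
Proof. by rewrite /dot mxE; apply: eq_bigr => i _; rewrite mxE. Qed.

Lemma dotC u v : dot u v = dot v u.
Proof. by rewrite !dotE; apply: eq_bigr => i _; rewrite mulrC. Qed.

Lemma dotDr u v w : dot u (v + w) = dot u v + dot u w.
Proof. by rewrite /dot mulmxDr mxE. Qed.

Lemma dotZr a u v : dot u (a *: v) = a * dot u v.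
Proof. by rewrite /dot -scalemxAr mxE. Qed.

Lemma dotNr u v : dot u (- v) = - dot u v.
Proof. by rewrite -scaleN1r dotZr mulN1r. Qed.

Lemma dotBr u v w : dot u (v - w) = dot u v - dot u w.
Proof. by rewrite dotDr dotNr. Qed.

Lemma dotDl u v w : dot (u + v) w = dot u w + dot v w.
Proof. by rewrite !(dotC _ w) dotDr. Qed.

Lemma dotZl a u v : dot (a *: u) v = a * dot u v.
Proof. by rewrite !(dotC _ v) dotZr. Qed.

Lemma dotBl u v w : dot (u - v) w = dot u w - dot v w.
Proof. by rewrite !(dotC _ w) dotBr. Qed.

Lemma dot0r u : dot u 0 = 0.
Proof. by rewrite -(scale0r 0) dotZr mul0r. Qed.

Lemma dot_ge0 u : 0 <= dot u u.
Proof. by rewrite dotE; apply: sumr_ge0 => i _; rewrite -expr2 sqr_ge0. Qed.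

Lemma dot_eq0 u : dot u u = 0 -> u = 0.
Proof.
move=> /eqP; rewrite dotE psumr_eq0 => [/allP u0|i _]; last first.
  by rewrite -expr2 sqr_ge0.
apply/matrixP => i j; rewrite ord1 mxE; apply/eqP.
by have := u0 i (mem_index_enum _); rewrite mulf_eq0 orbb.
Qed.

Lemma norm2_ge0 u : 0 <= norm2 u. Proof. exact: sqrtr_ge0. Qed.

Lemma norm2_sqr u : norm2 u ^+ 2 = dot u u.
Proof. by rewrite sqr_sqrtr// dot_ge0. Qed.

Lemma dot_mulmxr S u v : dot u (S *m v) = dot (S^T *m u) v.
Proof. by rewrite /dot trmx_mul trmxK mulmxA. Qed.

Lemma psd_sym S u v : psd S -> dot u (S *m v) = dot v (S *m u).
Proof. by case=> Ssym _; rewrite dot_mulmxr Ssym dotC. Qed.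

(** Expand the nonnegative forms at [u + v] and [u - v]; by symmetry of [S] the two cross terms
    coincide. *)
Lemma psd_young S u v : psd S ->
  `|dot u (S *m v)| <= (dot u (S *m u) + dot v (S *m v)) / 2.
Proof.
move=> Spsd; have [_ Sge0] := Spsd.
have := Sge0 (u + v); have := Sge0 (u - v).
rewrite !mulmxBr !mulmxDr !dotBl !dotBr !dotDl !dotDr (psd_sym v u Spsd).
by rewrite ler_norml; lra.
Qed.

(* With [n = |u|^2], the quadratic form summed over the vectors
   [n e_i - u_i u] gives [n (n tr S - u^T S u) >= 0]. *)
Lemma psd_le_trace S u : psd S -> dot u (S *m u) <= \tr S * dot u u.
Proof.
move=> Spsd; have [_ Sge0] := Spsd.
have [u0|un0] := eqVneq (dot u u) 0.
  by rewrite u0 (dot_eq0 u0) mulmx0 dot0r mulr0.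
have n_gt0 : 0 < dot u u by rewrite lt0r un0 dot_ge0.
pose n := dot u u; pose e i : 'cV[R]_d := delta_mx i 0.
have dote i v : dot (e i) v = v i 0.
  rewrite dotE (bigD1 i)//= big1 => [|j ji]; rewrite !mxE ?eqxx ?mul1r ?addr0//.
  by rewrite (negbTE ji) mul0r.
have eSe i : dot (e i) (S *m e i) = S i i.
  rewrite dote mxE (bigD1 i)//= big1 => [|j ji]; rewrite !mxE ?eqxx ?mulr1 ?addr0//.
  by rewrite (negbTE ji) mulr0.
have : 0 <= \sum_i dot (n *: e i - u i 0 *: u) (S *m (n *: e i - u i 0 *: u)).
  by apply: sumr_ge0 => i _; exact: Sge0.
have -> : \sum_i dot (n *: e i - u i 0 *: u) (S *m (n *: e i - u i 0 *: u)) =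
    n * (n * \tr S - dot u (S *m u)).
  transitivity (\sum_i (n ^+ 2 * S i i - n * 2 * (u i 0 * (S *m u) i 0) +
                        (u i 0 * u i 0) * dot u (S *m u))).
    apply: eq_bigr => i _; rewrite mulmxBr -!scalemxAr !dotBl !dotBr !dotZl !dotZr.
    by rewrite eSe (psd_sym u (e i) Spsd) !dote; ring.
  rewrite big_split sumrB /= -!mulr_sumr -mulr_suml -!dotE -/n /mxtrace; ring.
by rewrite pmulr_rge0// subr_ge0 mulrC.
Qed.

Lemma psd_trace_ge0 S : psd S -> 0 <= \tr S.
Proof.
move=> [_ Sge0]; apply: sumr_ge0 => i _; have := Sge0 (delta_mx i 0).
rewrite dotE (bigD1 i)//= big1 => [|j ji]; rewrite !mxE ?eqxx ?mul1r ?addr0//.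
  rewrite (bigD1 i)//= big1 => [|j ji]; rewrite ?mxE ?eqxx ?mulr1 ?addr0//.
  by rewrite (negbTE ji) mulr0.
by rewrite (negbTE ji) mul0r.
Qed.

Lemma loewner_le_dot S T u : loewner_le S T -> dot u (S *m u) <= dot u (T *m u).
Proof. by case=> _ /(_ u); rewrite mulmxBl dotBr subr_ge0. Qed.

(** [psd_young] at nu^-1 S u and u gives |S u|^2 <= (nu^-1 <S u, S S u> + nu <u, S u>) / 2. Bounding
    S by nu in both terms leaves (|S u|^2 + nu^2 |u|^2) / 2, and half of |S u|^2 is absorbed on the
    left. *)
Lemma psd_mulmx_sqr_le S nu u : 0 < nu -> psd S -> loewner_le S nu%:M ->
  dot (S *m u) (S *m u) <= nu ^+ 2 * dot u u.
Proof.
move=> nu_gt0 Spsd Snu.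
have := loewner_le_dot u Snu; rewrite mul_scalar_mx dotZr => uSu.
have := loewner_le_dot (S *m u) Snu; rewrite mul_scalar_mx dotZr => uSSSu.
have := le_trans (ler_norm _) (psd_young (nu^-1 *: (S *m u)) u Spsd).
rewrite -scalemxAr !dotZl !dotZr -(ler_pM2l nu_gt0) [X in X <= _]mulrA mulfV ?gt_eqF// mul1r.
move: uSu uSSSu; set a := dot (S *m u) (S *m u); set c := dot (S *m u) (S *m (S *m u)).
set e := dot u (S *m u) => uSu uSSSu.
have -> : nu * ((nu^-1 * (nu^-1 * c) + e) / 2) = (nu^-1 * c + nu * e) / 2.
  by field; rewrite gt_eqF.
have : nu^-1 * c <= a by rewrite mulrC ler_pdivrMr// mulrC.
have : nu * e <= nu ^+ 2 * dot u u by rewrite expr2 -mulrA ler_pM2l.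
by lra.
Qed.

Definition subspace V := V 0 /\ forall a u v, V u -> V v -> V (a *: u + v).

Lemma subspaceZ V a u : subspace V -> V u -> V (a *: u).
Proof. by case=> V0 VP Vu; rewrite -[_ *: _]addr0; exact: VP. Qed.

Lemma subspaceD V u v : subspace V -> V u -> V v -> V (u + v).
Proof. by case=> _ VP Vu Vv; rewrite -[u]scale1r; exact: VP. Qed.

(** Among the matrices whose row space lies in [V], one of maximal rank works: adjoining a vector of
    [V] as a further row cannot raise the rank, so that vector is already in the row space. *)
Lemma subspace_rowspace V : subspace V ->
  exists A : 'M[R]_d, forall v, V v <-> (v^T <= A)%MS.
Proof.
move=> Vsub; pose Q (A : 'M[R]_d) := forall u : 'rV[R]_d, (u <= A)%MS -> V u^T.
pose P r := `[< exists A : 'M[R]_d, Q A /\ \rank A = r >].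
have exP : exists r, P r.
  exists 0%N; apply/asboolP; exists 0; rewrite mxrank0; split=> // u.
  by rewrite submx0 => /eqP ->; rewrite trmx0; case: Vsub.
have ubP r : P r -> (r <= d)%N by move=> /asboolP[A [_ <-]]; exact: rank_leq_row.
case: (ex_maxnP exP ubP) => r /asboolP[A [QA rA]] rmax.
exists A => v; split=> [Vv|/QA]; last by rewrite trmxK.
have QAv : Q (A + v^T)%MS.
  move=> u /sub_addsmxP[[a c] /= ->]; rewrite linearD /=; apply: subspaceD => //.
    by apply: QA; exact: submxMl.
  by rewrite (mx11_scalar c) mul_scalar_mx linearZ /= trmxK; exact: subspaceZ.
have /rmax : P (\rank (A + v^T)%MS) by apply/asboolP; exists (A + v^T)%MS.
rewrite -rA => leA; apply: submx_trans (addsmxSr A v^T) _.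
rewrite -(mxrank_leqif_sup (addsmxSl A v^T)).2.
by rewrite eqn_leq leA mxrankS ?addsmxSl.
Qed.

(** With the rows of C a basis of the subspace, the projection is u^T C^T (C C^T)^-1 C,
    transposed. *)
Lemma subspace_orthogonal_decomposition V u : subspace V ->
  exists p, V p /\ forall v, V v -> dot (u - p) v = 0.
Proof.
move=> /subspace_rowspace[A VA].
have [C [CA Cfree]] : exists C : 'M[R]_(\rank A, d), (C :=: A)%MS /\ row_free C.
  by exists (row_base A); split; [exact: eq_row_base | exact: row_base_free].
(* If y C C^T = 0 then |y C|^2 = 0, so y C = 0, and y = 0 because the rows of C are free. *)
have gram_unit : C *m C^T \in unitmx.
  rewrite -row_free_unit -kermx_eq0 -submx0; apply/row_subP => i; rewrite submx0.
  have := row_sub i (kermx (C *m C^T)) => /sub_kermxP.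
  set y := row i _ => yCC; apply/eqP.
  have yC : (y *m C)^T = 0.
    by apply: dot_eq0; rewrite /dot trmxK trmx_mul mulmxA -(mulmxA y) yCC mul0mx mxE.
  by apply: (row_free_inj Cfree); rewrite mul0mx -[LHS]trmxK yC trmx0.
exists (u^T *m C^T *m invmx (C *m C^T) *m C)^T; split.
  by apply/VA; rewrite trmxK -CA submxMl.
move=> v /VA; rewrite -CA => /submxP[y] /(congr1 trmx).
rewrite trmxK trmx_mul => ->.
rewrite /dot linearB /= trmxK mulmxBl !mulmxA -(mulmxA _ C C^T) mulmxKV//.
by rewrite subrr mxE.
Qed.

Lemma oprojP V u : subspace V ->
  V (oproj V u) /\ forall v, V v -> dot (u - oproj V u) v = 0.
Proof. by move=> /(subspace_orthogonal_decomposition u)/xgetPex; exact. Qed.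

Lemma oproj_dot V u v : subspace V -> V v -> dot v (oproj V u) = dot v u.
Proof.
move=> /oprojP => /(_ u)[_ /[apply]]; rewrite dotBl => /eqP.
by rewrite subr_eq0 !(dotC v) eq_sym => /eqP.
Qed.

Lemma oproj_sqr_le V u : subspace V -> dot (oproj V u) (oproj V u) <= dot u u.
Proof.
move=> Vsub; have [Vp orth] := oprojP u Vsub; set p := oproj V u in Vp orth *.
have := orth _ Vp; rewrite dotBl => up; have := dot_ge0 (u - p).
by rewrite !dotBl !dotBr (dotC p u); lra.
Qed.

End LinearAlgebra.

(** * Smooth maps and lines *)

Section Smooth.
Context {R : realType} {V W : normedModType R}.
Implicit Types (f g : V -> W) (U : set V).

Lemma is_derive_comp_diff (c : R -> V) (g : V -> W) (t : R) (v : V) :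
  is_derive t (1 : R) c v -> differentiable g (c t) ->
  is_derive t (1 : R) (g \o c) ('d g (c t) v).
Proof.
move=> cv dg; have dc : differentiable c t.
  by apply/derivable1_diffP; exact: ex_derive.
have dgc := differentiable_comp dc dg.
apply: DeriveDef; first exact/derivable1_diffP.
rewrite (deriveE _ dgc) (diff_comp dc dg) /= -(deriveE _ dc).
by rewrite (@derive_val _ _ _ _ _ _ _ cv).
Qed.

(** Made for functions [F] that are meaningful only on a set [S]: a curve staying in [S] cannot
    distinguish [F] from its differentiable extension [g]. *)
Lemma is_derive_comp_near (S : set V) (F g : V -> W) (c : R -> V) (t : R) (v : V) :
  is_derive t (1 : R) c v -> (\forall u \near t, S (c u)) ->
  differentiable g (c t) -> (\forall y \near c t, S y -> F y = g y) ->
  is_derive t (1 : R) (F \o c) ('d g (c t) v).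
Proof.
move=> cv Sc dg Fg.
apply: near_eq_is_derive (is_derive_comp_diff cv dg).
have cc : {for t, continuous c}.
  by apply/differentiable_continuous/derivable1_diffP; exact: ex_derive.
by apply: filterS2 Sc (cc _ Fg) => u Su /(_ Su) /esym.
Qed.

Lemma near_eq_differentiable f g (x : V) : (\near x, f x = g x) ->
  differentiable f x -> differentiable g x.
Proof.
move=> fg df; have [dfc fE] := (diff_locallyP _ _).1 df.
have gE : g \o shift x = cst (g x) + 'd f x +o_ 0 id.
  apply/eqaddoP => e e0; have := (eqaddoP _ _ _ _).1 fE e e0.
  have fgx : f x = g x := nbhs_singleton fg.
  have : \forall y \near 0, f (y + x) = g (y + x) by move: fg; rewrite (near_shift 0) subr0.
  by apply: filterS2 => y /= fgy; rewrite /= !fctE /= fgx fgy.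
by apply/diff_locallyP; rewrite (diff_unique dfc gE).
Qed.

Lemma Cn_eq n U f g : open U -> (forall y, U y -> f y = g y) ->
  Cn n U f -> Cn n U g.
Proof.
move=> Uo; elim: n f g => [|n IH] f g fg /=.
  move=> cf y Uy; have nfg : \forall z \near y, f z = g z.
    by apply: filterS (open_nbhs_nbhs (conj Uo Uy)).
  suff : g z @[z --> y] --> g y by [].
  by rewrite -(fg _ Uy); apply: cvg_trans (cf _ Uy); exact: near_eq_cvg.
move=> [df Df]; split=> [y Uy|v].
  apply: near_eq_differentiable (df _ Uy).
  exact: filterS (open_nbhs_nbhs (conj Uo Uy)).
apply: IH (Df v) => y Uy; apply: near_eq_derive.
exact: filterS (open_nbhs_nbhs (conj Uo Uy)).
Qed.

Lemma Cn_subset n U U' f : U `<=` U' -> Cn n U' f -> Cn n U f.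
Proof.
move=> UU'; elim: n f => [|n IH] f /=; first by move=> cf y /UU'/cf.
by move=> [df Df]; split=> [y /UU'/df|v]; [|exact: IH].
Qed.

Lemma Cn_cst n U (a : W) : Cn n U (cst a).
Proof.
elim: n a => [|n IH] a /=; first by move=> y _; exact: cst_continuous.
split=> [y _|v]; first exact: differentiable_cst.
suff -> : 'D_v (cst a) = cst (0 : W) :> (V -> W) by exact: IH.
by apply/funext => y; rewrite derive_cst.
Qed.

End Smooth.

Section Lines.
Context {R : realType} {V W : normedModType R}.

Lemma differentiable_line (p w : V) (t : R) :
  differentiable (fun t : R => p + t *: w) t.
Proof. by apply: differentiableD => //; exact: differentiableZl. Qed.

Lemma derive_line (p w : V) (t v : R) :
  'D_v (fun t : R => p + t *: w) t = v *: w.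
Proof.
rewrite deriveE; last exact: differentiable_line.
have df : is_diff t (cst p + ( *:%R ^~ w : R -> V)) (0 + ( *:%R ^~ w : R -> V)).
  exact: is_diffD.
by have /= -> := @diff_val _ _ _ _ _ _ _ df; rewrite /= add0r.
Qed.

Lemma is_derive_line (p w : V) (t : R) :
  is_derive t (1 : R) (fun t : R => p + t *: w) w.
Proof.
apply: DeriveDef; first exact/derivable1_diffP/differentiable_line.
by rewrite derive_line scale1r.
Qed.

Lemma smooth_line (p w : V) (U : set R) : smooth U (fun t : R => p + t *: w).
Proof.
case=> [t _|n]; first exact/differentiable_continuous/differentiable_line.
split=> [t _|v]; first exact: differentiable_line.
suff -> : 'D_v (fun t : R => p + t *: w) = cst (v *: w) :> (R -> V).
  exact: Cn_cst.
by apply/funext => t; rewrite derive_line.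
Qed.

(** The derivative of the composite in direction [v] is the derivative of [f] in direction [v *: w],
    again composed with the same line, so the induction on [n] closes. *)
Lemma Cn_comp_line n (U : set V) (f : V -> W) (p w : V) : open U -> Cn n U f ->
  Cn n [set t : R | U (p + t *: w)] (fun t : R => f (p + t *: w)).
Proof.
move=> Uo; pose a (t : R) := p + t *: w.
have ac : continuous a.
  by move=> t; exact/differentiable_continuous/differentiable_line.
have aUo : open [set t : R | U (a t)] by move/continuousP: ac; exact.
elim: n f => [|n IH] f /=.
  by move=> cf t /cf; apply: (@continuous_comp _ _ _ a); exact: ac.
move=> [df Df].
have dfa t : U (a t) -> differentiable (f \o a) t.
  by move=> /df; apply: differentiable_comp; exact: differentiable_line.
split=> [t /dfa //|v].
apply: (Cn_eq aUo (f := fun t => 'D_(v *: w) f (a t))); last exact: (IH _ (Df _)).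
move=> t Ut; rewrite (deriveE _ (df _ Ut)) [RHS](deriveE _ (dfa _ Ut)).
rewrite (diff_comp (differentiable_line p w t) (df _ Ut)) /=.
by rewrite -[in RHS](deriveE _ (differentiable_line p w t)) derive_line.
Qed.

End Lines.

(** * Tangent spaces, gradients and the descent inequality *)

Section Submanifold.
Context {R : realType} {d : nat}.
Implicit Types (M : set 'cV[R]_d) (x v eta : 'cV[R]_d).

Lemma curve_at_near M x v (c : R -> 'cV[R]_d) :
  curve_at M x v c -> \forall t \near (0 : R), M (c t).
Proof.
by move=> [_ [_ [e e0 [_ Mc]]]]; exists e.
Qed.

Lemma curve_at_comp (W : normedModType R) M x v c (F g : 'cV[R]_d -> W) :
  curve_at M x v c -> differentiable g x ->
  (\forall y \near x, M y -> F y = g y) ->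
  is_derive (0 : R) 1 (F \o c) ('d g x v).
Proof.
move=> cv; have [<- [dc _]] := cv.
by move=> dg Fg; apply: is_derive_comp_near dc _ dg Fg; exact: curve_at_near cv.
Qed.

(** Every curve with velocity [v] yields the value ['d g x v], so the curve behind the choice in
    [Dmap] is immaterial. *)
Lemma DmapE (W : normedModType R) M x v (F g : 'cV[R]_d -> W) :
  tangent M x v -> differentiable g x -> (\forall y \near x, M y -> F y = g y) ->
  Dmap M F x v = 'd g x v.
Proof.
move=> [c cv] dg Fg; rewrite /Dmap; set D := (X in xget 0 X).
have [c' cv' dF] : D (xget 0 D).
  by apply: xgetPex; exists ('d g x v), c => //; exact: (curve_at_comp cv).
have dF' := curve_at_comp cv' dg Fg.
by rewrite -(@derive_val _ _ _ _ _ _ _ dF) (@derive_val _ _ _ _ _ _ _ dF').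
Qed.

Lemma tangent_line (V : set 'cV[R]_d) x v : subspace V -> V x -> V v ->
  curve_at V x v (fun t : R => x + t *: v).
Proof.
move=> Vsub Vx Vv; split; first by rewrite scale0r addr0.
split; first exact: is_derive_line.
exists 1 => //; split=> [|t _]; first exact: smooth_line.
by apply: subspaceD => //; exact: subspaceZ.
Qed.

Lemma is_derive_coord (c : R -> 'cV[R]_d) t v (i : 'I_d) :
  is_derive t (1 : R) c v -> is_derive t (1 : R) (fun u => c u i 0) (v i 0).
Proof.
move=> cv; have h := is_derive_comp_diff cv (differentiable_coord (c t) i 0).
have -> // : v i 0 = 'd (fun N : 'cV[R]_d => N i 0 : R) (c t) v.
have lc : linear (fun N : 'cV[R]_d => N i 0 : R).
  by move=> a u w; rewrite !mxE.
pose L := GRing.isLinear.Build _ _ _ _ _ lc.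
pose f : {linear 'cV[R]_d -> R} := HB.pack (fun N : 'cV[R]_d => N i 0 : R) L.
by rewrite (@diff_lin _ _ _ f)// => y; exact: coord_continuous.
Qed.

(** In a slice chart the tangent space is the kernel of the last coordinates of the differential of
    the chart; linearity of the tangent space follows from this description. *)
Lemma tangentP M x : embedded_submanifold M -> M x ->
  exists (m : nat) (D : {linear 'cV[R]_d -> 'cV[R]_d}),
    tangent M x = [set v | forall i : 'I_d, (m <= i)%N -> D v i 0 = 0].
Proof.
move=> [m md charts] Mx.
have [U [F [F' [[Uo Ux] FUo [sF sF'] F'F UM]]]] := charts _ Mx.
exists m, ('d F x); apply/seteqP; split=> v /=.
  move=> [c cv] i mi; have [c0 [dc _]] := cv.
  have dF : differentiable F (c 0) by have [dF _] := sF 1%N; rewrite c0; exact: dF.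
  have h := is_derive_coord i (is_derive_comp_diff dc dF).
  have h0 : is_derive (0 : R) 1 (fun u => (F \o c) u i 0) 0.
    apply: near_eq_is_derive (is_derive_cst _ _ _).
    have cU : \forall t \near (0 : R), U (c t).
      have cc : {for 0, continuous c}.
        by apply/differentiable_continuous/derivable1_diffP; exact: ex_derive.
      by apply: cc; rewrite c0; exact: open_nbhs_nbhs.
    apply: filterS2 cU (curve_at_near cv) => t Uct Mct.
    by rewrite /= ((UM _ Uct).1 Mct _ mi).
  by rewrite -c0 -(@derive_val _ _ _ _ _ _ _ h) (@derive_val _ _ _ _ _ _ _ h0).
(* Conversely, the straight line through [p] with velocity [w] stays in the flat slice, and [F']
   carries it back to a curve in [M]. Its velocity is [v] because [F' \o F] is the identity near
   [x]. *)
move=> Dv; pose p := F x; pose w := 'd F x v.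
have dF : differentiable F x by have [dF _] := sF 1%N; exact: dF.
have FUp : (F @` U) p by exists x.
have dF' : differentiable F' p by have [dF' _] := sF' 1%N; exact: dF'.
have ao : \forall t \near (0 : R), (F @` U) (p + t *: w).
  have : {for (0 : R), continuous (fun t : R => p + t *: w)}.
    exact/differentiable_continuous/differentiable_line.
  by apply; rewrite scale0r addr0; exact: open_nbhs_nbhs.
have [e /= e0 eU] := ao.
exists (fun t => F' (p + t *: w)); split; first by rewrite scale0r addr0 F'F.
split.
  have dl := is_derive_line p w 0.
  have := is_derive_comp_diff (g := F') dl; rewrite scale0r addr0 => /(_ dF').
  suff -> : 'd F' p w = v by [].
  rewrite -[LHS]/(('d F' p \o 'd F x) v) -diff_comp//.
  have dFF : differentiable (F' \o F) x by exact: differentiable_comp.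
  rewrite -(deriveE _ dFF).
  have -> : 'D_v (F' \o F) x = 'D_v id x.
    apply: near_eq_derive.
    by apply: filterS (open_nbhs_nbhs (conj Uo Ux)) => y /F'F.
  by rewrite derive_id.
exists e => //; split.
  move=> n; apply: (Cn_subset (U' := [set t | (F @` U) (p + t *: w)])) => //.
  exact: Cn_comp_line.
move=> t /eU [y Uy yE]; rewrite -yE F'F//; apply/UM => // i mi.
by rewrite yE !mxE /w (Dv i mi) mulr0 addr0; apply: (UM _ Ux).1.
Qed.

Lemma tangent_subspace M x : embedded_submanifold M -> M x -> subspace (tangent M x).
Proof.
move=> Msub /(tangentP Msub)[m [D ->]]; split=> [i _|a u v Du Dv i mi] /=.
  by rewrite linear0 mxE.
by rewrite linearP !mxE Du// Dv// mulr0 addr0.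
Qed.

(* On the tangent space the differential of a local extension is represented by
   a vector of R^d, which is then projected. *)
Lemma rgradP M (f : 'cV[R]_d -> R) x : embedded_submanifold M -> M x ->
  (exists2 g : 'cV[R]_d -> R, differentiable g x &
     \forall y \near x, M y -> f y = g y) ->
  tangent M x (rgrad M f x) /\
  forall eta, tangent M x eta -> dot (rgrad M f x) eta = Dmap M f x eta.
Proof.
move=> Msub Mx [g dg fg]; have Tsub := tangent_subspace Msub Mx.
suff ex : exists u, tangent M x u /\
    forall eta, tangent M x eta -> dot u eta = Dmap M f x eta.
  exact: (xgetPex 0 ex).
pose a : 'cV[R]_d := \col_i 'd g x (delta_mx i 0).
exists (oproj (tangent M x) a); split; first exact: (oprojP a Tsub).1.
move=> eta Teta; rewrite dotC oproj_dot// (DmapE Teta dg fg) dotE.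
rewrite [in RHS](matrix_sum_delta eta) linear_sum; apply: eq_bigr => i _.
by rewrite big_ord1 linearZ /= mxE.
Qed.

(** The default value [0] of [xget] is tangent as well. *)
Lemma rgrad_tangent M (f : 'cV[R]_d -> R) x : M x -> subspace (tangent M x) ->
  tangent M x (rgrad M f x).
Proof.
move=> Mx Tsub; rewrite /rgrad; case: xgetP => [u -> []//|_].
exact: Tsub.1.
Qed.

Lemma smooth_on_local (W : normedModType R) (V : normedModType R) (S : set V)
    (f : V -> W) (x : V) : smooth_on S f -> S x ->
  exists2 g : V -> W, differentiable g x & \forall y \near x, S y -> f y = g y.
Proof.
move=> fS /fS[U [g [Uo Ux sg fg]]]; exists g; first by have [dg _] := sg 1%N; exact: dg.
apply: filterS (open_nbhs_nbhs (conj Uo Ux)) => y Uy Sy; exact: fg.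
Qed.

Lemma mean_fun_local N M (f : 'I_N -> 'cV[R]_d -> R) x :
  (forall i, smooth_on M (f i)) -> M x ->
  exists2 g : 'cV[R]_d -> R, differentiable g x &
    \forall y \near x, M y -> mean_fun f y = g y.
Proof.
move=> sf Mx.
have [g dg fg] := fin_all_exists2 (fun i => smooth_on_local (sf i) Mx).
exists (N%:R^-1 *: \sum_(i < N) g i).
  by apply: differentiableZ; apply: differentiable_sum => i; exact: dg.
have near_fg : \forall y \near x, forall i, M y -> f i y = g i y.
  exact: (@filter_forall _ _ (fun i y => M y -> f i y = g i y) (nbhs x) _ fg).
apply: filterS near_fg => y fgy My; rewrite /mean_fun fctE fct_sumE; congr (_ * _).
by apply: eq_bigr => i _; rewrite fgy.
Qed.

(** Local extensions of [r] and of [f] compose: on tangent vectors the extension of [r] agrees with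
    [r], hence lands in [M], where the extension of [f] agrees with [f]. *)
Lemma retraction_comp_local M r (f : 'cV[R]_d -> R) x v :
  retraction M r ->
  (forall y, M y -> exists2 g : 'cV[R]_d -> R, differentiable g y &
     \forall z \near y, M z -> f z = g z) ->
  M x -> tangent M x v ->
  exists2 g : 'cV[R]_d -> R, differentiable g v &
    \forall w \near v, tangent M x w -> f (r (x, w)) = g w.
Proof.
move=> [rs rM _ _] fl Mx Tv; have TMxv : tangent_bundle M (x, v) by [].
have [q dq rq] := smooth_on_local rs TMxv.
have rqxv : r (x, v) = q (x, v) := nbhs_singleton rq TMxv.
have [g dg fg] := fl _ (rM _ TMxv).
have dx : differentiable (fun w => (x, w)) v.
  by apply: differentiable_pair => //; exact: differentiable_id.
have dqx : differentiable (q \o (fun w => (x, w))) v by exact: differentiable_comp.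
exists (g \o (q \o (fun w => (x, w)))).
  by apply: differentiable_comp => //=; rewrite -rqxv.
have near_rq : \forall w \near v, tangent_bundle M (x, w) -> r (x, w) = q (x, w).
  by have cx := differentiable_continuous dx; exact: (cx _ rq).
have near_fg : \forall w \near v, M (q (x, w)) -> f (q (x, w)) = g (q (x, w)).
  have cqx := differentiable_continuous dqx.
  have fg' : nbhs ((q \o (fun w => (x, w))) v) [set z | M z -> f z = g z].
    by rewrite /= -rqxv.
  exact: (cqx _ fg').
apply: filterS2 near_fg near_rq => w fgw rqw Tw.
have TMxw : tangent_bundle M (x, w) by [].
by rewrite rqw// fgw// -rqw//; exact: rM.
Qed.

(* For [0 < t < 1], (A4) at [t eta], divided by [t], bounds the derivative of
   [t |-> f (R_x (t eta))] by [D f(x)[eta] + t L |eta|^2]. *)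
Lemma retraction_descent M r (f : 'cV[R]_d -> R) (L : R) x eta :
  embedded_submanifold M -> retraction M r ->
  (forall y, M y -> exists2 g : 'cV[R]_d -> R, differentiable g y &
     \forall z \near y, M z -> f z = g z) ->
  (forall y eta, M y -> tangent M y eta ->
     `|Dmap (tangent M y) (fun v => f (r (y, v))) eta eta - Dmap M f y eta|
     <= L * norm2 eta ^+ 2) ->
  M x -> tangent M x eta ->
  f (r (x, eta)) <= f x + dot (rgrad M f x) eta + L * dot eta eta / 2.
Proof.
move=> Msub rr fl A4 Mx Teta; have Tsub := tangent_subspace Msub Mx.
have TZ t : tangent M x (t *: eta) by exact: subspaceZ.
have gradE v : tangent M x v -> Dmap M f x v = dot (rgrad M f x) v.
  by move=> Tv; rewrite (rgradP Msub Mx (fl _ Mx)).2.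
set D := dot _ eta; set n := dot eta eta.
pose F v := f (r (x, v)).
have hder t : exists h' : R, is_derive t (1 : R) (fun t : R => F (t *: eta)) h' /\
    Dmap (tangent M x) F (t *: eta) (t *: eta) = t * h'.
  have [g dg Fg] := retraction_comp_local rr fl Mx (TZ t).
  exists ('d g (t *: eta) eta); split.
    have := is_derive_line 0 eta t.
    have -> : (fun t : R => 0 + t *: eta) = (fun t : R => t *: eta).
      by apply/funext => u; rewrite add0r.
    move=> dl; apply: (is_derive_comp_near (S := tangent M x) dl) => //.
    exact: (@filterE _ (nbhs t) _ (fun u => tangent M x (u *: eta))).
  (* The differential is taken within the linear space [tangent M x], where a straight line is an
     admissible curve; linearity extracts the factor [t]. *)
  rewrite (DmapE _ dg Fg) ?linearZ//.
  by exists (fun u : R => t *: eta + u *: (t *: eta)); exact: tangent_line.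
have [h' h'P] := choice hder.
(* Integration is carried out by the mean value theorem on [0, 1] for the function minus its
   quadratic bound; [q'] is the derivative of this difference, and (A4) makes it nonpositive. *)
pose q' t := h' t - D - t * (L * n).
have qder t : is_derive t (1 : R)
    (fun t : R => F (t *: eta) - t * D - t ^+ 2 * (L * n / 2)) (q' t).
  have dD : is_derive t (1 : R) (fun t : R => t * D) D.
    have := is_derive_line (0 : R) D t.
    by have -> : (fun t : R => 0 + t *: D) = (fun t : R => t * D)
      by apply/funext => u; rewrite add0r.
  have dn : is_derive t (1 : R) (fun t : R => t ^+ 2 * (L * n / 2)) (t * (L * n)).
    have -> : (fun t : R => t ^+ 2 * (L * n / 2)) = (L * n / 2) *: (id ^+ 2 : R -> R).
      by apply/funext => u; rewrite /= [RHS]mulrC.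
    by apply: is_derive_eq; rewrite /GRing.scale /=; field.
  exact: is_deriveB (is_deriveB (h'P t).1 dD) dn.
have [|c c01] := MVT (@ltr01 R) (fun t _ => qder t).
  apply: continuous_subspaceT => t.
  by apply/differentiable_continuous/derivable1_diffP; exact: ex_derive.
rewrite subr0 mulr1 scale1r scale0r; move: c01; rewrite in_itv /= => /andP[c0 c1].
have q'le0 : q' c <= 0.
  have := A4 x (c *: eta) Mx (TZ c).
  rewrite (h'P c).2 gradE// norm2_sqr !dotZr dotZl -/D -/n.
  have -> : c * h' c - c * D = c * (h' c - D) by ring.
  have -> : L * (c * (c * n)) = c * (c * (L * n)) by ring.
  move=> /(le_trans (ler_norm _)); rewrite ler_pM2l// /q'; lra.
have r0 : F 0 = f x by rewrite /F; have [_ _ -> //] := rr.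
move: q'le0; rewrite r0 /F; lra.
Qed.

End Submanifold.

(** * Finite-valued random variables *)

Section DeterminedBy.
Context {Om : Type}.

(** For a discrete finite-valued [X] this replaces measurability with respect to [X]. *)
Definition determined_by (T U : Type) (X : Om -> T) (u : Om -> U) :=
  forall w w', X w = X w' -> u w = u w'.

Lemma determined_byP (T : Type) (U : pointedType) (X : Om -> T) (u : Om -> U) :
  determined_by X u -> exists F : T -> U, u = F \o X.
Proof.
move=> Xu; pose F t := xget point [set y | exists2 w, X w = t & y = u w].
exists F; apply/funext => w /=; rewrite /F.
case: xgetP => [y _ [w' Xw ->]|/(_ (u w)) h]; first exact: Xu.
by exfalso; apply: h; exists w.
Qed.

End DeterminedBy.

Section FiniteRandomVariables.
Context {disp : measure_display} {Om : measurableType disp} {R : realType}.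
Variable P : probability Om R.

Definition EX (u : Om -> R) : R := fine ('E_P[u])%E.

Definition mass (T : Type) (X : Om -> T) (a : T) : R := fine (P (X @^-1` [set a])).

(** Independence is tested on atoms, which suffices for finite-valued variables. *)
Definition independent_rv (T T' : Type) (X : Om -> T) (Y : Om -> T') :=
  forall a t, P (X @^-1` [set a] `&` Y @^-1` [set t]) =
              (P (X @^-1` [set a]) * P (Y @^-1` [set t]))%E.

Lemma mass_ge0 (T : Type) (X : Om -> T) a : 0 <= mass X a.
Proof. exact/fine_ge0/measure_ge0. Qed.

Lemma expectation_finite (T : finType) (X : Om -> T) (F : T -> R) :
  discrete_rv X -> 'E_P[F \o X]%E = (\sum_t F t * mass X t)%:E.
Proof.
move=> Xd; rewrite unlock.
have indE w : (F (X w))%:E =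
    (\sum_t (F t)%:E * (\1_(X @^-1` [set t]) w)%:E)%E.
  rewrite (bigD1 (X w))//= big1 => [|t tX].
    by rewrite adde0 indicE mem_set// mule1.
  by rewrite indicE memNset ?mule0//= => /esym/eqP; apply/negP.
rewrite (eq_integral _ _ (fun w _ => indE w)) integral_sum//; last first.
  by move=> t; apply: integrableZl => //; exact: integrable_indic.
rewrite -sumEFin; apply: eq_bigr => t _.
rewrite integralZl//; last exact: integrable_indic.
rewrite integral_indic// setIT EFinM; congr (_ * _)%E.
by rewrite fineK// fin_num_measure.
Qed.

Lemma EX_finite (T : finType) (X : Om -> T) (F : T -> R) :
  discrete_rv X -> EX (F \o X) = \sum_t F t * mass X t.
Proof. by move=> Xd; rewrite /EX expectation_finite. Qed.

Lemma expectation_EX (T : finType) (X : Om -> T) (u : Om -> R) :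
  discrete_rv X -> determined_by X u -> 'E_P[u]%E = (EX u)%:E.
Proof.
by move=> Xd /determined_byP[F ->]; rewrite EX_finite ?expectation_finite.
Qed.

(** A fibre of nonzero mass cannot lie in a negligible set. This turns almost sure inequalities into
    termwise inequalities of finite sums, where atoms of mass zero contribute nothing. *)
Lemma ae_mass (T : Type) (X : Om -> T) (t : T) (Q : Om -> Prop) :
  measurable (X @^-1` [set t]) -> {ae P, forall w, Q w} -> mass X t != 0 ->
  exists2 w, X w = t & Q w.
Proof.
move=> mXt aeQ; apply: contra_neqP => noQ.
have : P.-negligible (X @^-1` [set t]).
  by apply: negligibleS aeQ => w /= Xw Qw; apply: noQ; exists w.
by move=> /(negligibleP _ mXt) h; rewrite /mass h.
Qed.

Lemma EX_ae_le (T : finType) (X : Om -> T) (u v : Om -> R) :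
  discrete_rv X -> determined_by X u -> determined_by X v ->
  {ae P, forall w, u w <= v w} -> EX u <= EX v.
Proof.
move=> Xd /determined_byP[F ->] /determined_byP[G ->] uv.
rewrite !EX_finite//; apply: ler_sum => t _.
have [->|/(ae_mass (Xd _) uv)[w <- Fw]] := eqVneq (mass X t) 0.
  by rewrite !mulr0.
by apply: ler_wpM2r => //; exact: mass_ge0.
Qed.

Lemma EXD (T : finType) (X : Om -> T) (u v : Om -> R) :
  discrete_rv X -> determined_by X u -> determined_by X v ->
  EX (fun w => u w + v w) = EX u + EX v.
Proof.
move=> Xd /determined_byP[F ->] /determined_byP[G ->].
rewrite (EX_finite (fun t => F t + G t) Xd) !EX_finite// -big_split /=.
by apply: eq_bigr => t _; rewrite mulrDl.
Qed.

Lemma EXZ (T : finType) (X : Om -> T) (u : Om -> R) (a : R) :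
  discrete_rv X -> determined_by X u -> EX (fun w => a * u w) = a * EX u.
Proof.
move=> Xd /determined_byP[F ->].
rewrite (EX_finite (fun t => a * F t) Xd) !EX_finite// mulr_sumr.
by apply: eq_bigr => t _; rewrite mulrA.
Qed.

Lemma EX_cst (a : R) : EX (fun=> a) = a.
Proof. by rewrite /EX expectation_cst. Qed.

Lemma EX_sum (T : finType) (X : Om -> T) (I : finType) (F : I -> Om -> R) :
  discrete_rv X -> (forall i, determined_by X (F i)) ->
  EX (fun w => \sum_i F i w) = \sum_i EX (F i).
Proof.
move=> Xd XF.
have [G FG] := fin_all_exists (fun i => determined_byP (XF i)).
have -> : (fun w => \sum_i F i w) = (fun t => \sum_i G i t) \o X.
  by apply/funext => w; apply: eq_bigr => i _; rewrite FG.
rewrite EX_finite//; under eq_bigr do rewrite mulr_suml.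
by rewrite exchange_big; apply: eq_bigr => i _; rewrite FG EX_finite.
Qed.

(** Fubini for finite sums: the inner expectation averages over [Y] with the value of [X] frozen, as
    [E_k] does. *)
Lemma EX_independent (T T' : finType) (X : Om -> T) (Y : Om -> T')
    (phi : T -> T' -> R) :
  discrete_rv X -> discrete_rv Y -> independent_rv X Y ->
  EX (fun w => phi (X w) (Y w)) = EX (fun w => EX (fun w' => phi (X w) (Y w'))).
Proof.
move=> Xd Yd XY; pose Z w := (X w, Y w).
have Zd : discrete_rv Z.
  move=> A; have -> : Z @^-1` A = \big[setU/set0]_(p : T * T' | p \in A)
      (X @^-1` [set p.1] `&` Y @^-1` [set p.2]).
    apply/seteqP; split=> w /=; rewrite -bigcup_seq_cond.
      by move=> Aw; exists (Z w) => //=; rewrite mem_index_enum/= mem_set.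
    by move=> [[a t] /= /andP[_ /set_mem Aat] [Xw Yw]]; rewrite /Z Xw Yw.
  by apply: bigsetU_measurable => p _; apply: measurableI; [exact: Xd|exact: Yd].
have massZ a t : mass Z (a, t) = mass X a * mass Y t.
  rewrite /mass; have -> : Z @^-1` [set (a, t)] = X @^-1` [set a] `&` Y @^-1` [set t].
    by apply/seteqP; split=> w /=; rewrite /Z => -[Xw Yw]; rewrite Xw Yw.
  by rewrite XY fineM// fin_num_measure.
rewrite (EX_finite (fun p => phi p.1 p.2) Zd).
rewrite (EX_finite (fun a => EX (fun w' => phi a (Y w'))) Xd).
transitivity (\sum_a \sum_t phi a t * mass Z (a, t)).
  by rewrite pair_bigA; apply: eq_bigr => -[a t].
apply: eq_bigr => a _; rewrite (EX_finite (phi a) Yd) mulr_suml.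
by apply: eq_bigr => t _; rewrite massZ; ring.
Qed.

End FiniteRandomVariables.

(** * The vector of the samples drawn so far *)

Section JointHistory.
Context {Om : Type} {T : nat -> finType} (s : forall k, Om -> T k).

(** The function type is dependent because the batch size varies with the step; the shift to [j.+1]
    skips the junk index 0. *)
Definition joint (k : nat) (w : Om) : {dffun forall j : 'I_k, T j.+1} :=
  [ffun j : 'I_k => s j.+1 w].

Lemma jointP k w w' : joint k w = joint k w' <->
  forall j, (0 < j <= k)%N -> s j w = s j w'.
Proof.
split=> [/ffunP jw [|j] //= jk|sw].
  by have := jw (Ordinal jk); rewrite !ffunE.
by apply/ffunP => j; rewrite !ffunE; apply: sw; rewrite /= ltn_ord.
Qed.

Lemma joint_le j k w w' : (j <= k)%N -> joint k w = joint k w' ->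
  joint j w = joint j w'.
Proof.
move=> jk /jointP h; apply/jointP => i /andP[i0 ij].
by apply: h; rewrite i0 (leq_trans ij).
Qed.

Lemma joint_fiber k w0 : joint k @^-1` [set joint k w0] =
  \bigcap_(j in [set` iota 1 k]) (s j @^-1` [set s j w0]).
Proof.
apply/seteqP; split=> w /=.
  by move=> /jointP h j /=; rewrite mem_iota add1n ltnS => /h.
by move=> h; apply/jointP => j jk; apply: h => /=; rewrite mem_iota add1n ltnS.
Qed.

End JointHistory.

Section JointIndependence.
Context {disp : measure_display} {Om : measurableType disp} {R : realType}.
Variable P : probability Om R.
Context {T : nat -> finType} (s : forall k, Om -> T k).

Lemma discrete_joint k : (forall j, (0 < j)%N -> discrete_rv (s j)) ->
  discrete_rv (joint s k).
Proof.
move=> sd A; have -> : joint s k @^-1` A =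
    \big[setU/set0]_(a | a \in A) (joint s k @^-1` [set a]).
  apply/seteqP; split=> w /=; rewrite -bigcup_seq_cond.
    by move=> Aw; exists (joint s k w) => //=; rewrite mem_index_enum/= mem_set.
  by move=> [a /= /andP[_ /set_mem Aa] ->].
apply: bigsetU_measurable => a _.
have [[w0 <-]|na] := pselect (exists w, joint s k w = a).
  rewrite joint_fiber; apply: fin_bigcap_measurable => // j /=.
  by rewrite mem_iota => /andP[j0 _]; exact: sd.
suff -> : joint s k @^-1` [set a] = set0 by [].
by apply/seteqP; split=> // w /= wa; apply: na; exists w.
Qed.

(** The product formula is applied to the first [k] indices and to the first [k.+1]; the two
    products differ by the last factor. *)
Lemma joint_independent k : mutually_independent P [set j | (0 < j)%N] s ->
  (forall j, (0 < j)%N -> discrete_rv (s j)) ->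
  independent_rv P (joint s k) (s k.+1).
Proof.
move=> sI sd a t.
have [[w0 <-]|na] := pselect (exists w, joint s k w = a); last first.
  have -> : joint s k @^-1` [set a] = set0.
    by apply/seteqP; split=> // w /= wa; apply: na; exists w.
  by rewrite set0I measure0 mul0e.
have [[w1 <-]|nt] := pselect (exists w, s k.+1 w = t); last first.
  have -> : s k.+1 @^-1` [set t] = set0.
    by apply/seteqP; split=> // w /= wt; apply: nt; exists w.
  by rewrite setI0 measure0 mule0.
(* One family of events serves both index lists. Since [T j] varies with [j], its values are written
   through sample points [w0] and [w1], which exist once the empty fibres are set aside. *)
pose A j : set (T j) := [set s j (if j == k.+1 then w1 else w0)].
have Ak : A k.+1 = [set s k.+1 w1] by rewrite /A eqxx.
have Aj j : j \in iota 1 k -> A j = [set s j w0].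
  by rewrite mem_iota add1n ltnS => /andP[_ jk]; rewrite /A ltn_eqF.
have jointE : joint s k @^-1` [set joint s k w0] =
    \bigcap_(j in [set` iota 1 k]) (s j @^-1` A j).
  by rewrite joint_fiber; apply: eq_bigcapr => j /= /Aj ->.
have iotaE : iota 1 k.+1 = iota 1 k ++ [:: k.+1] by rewrite -[in LHS](addn1 k) iotaD add1n.
have jointSE : joint s k @^-1` [set joint s k w0] `&` s k.+1 @^-1` [set s k.+1 w1] =
    \bigcap_(j in [set` iota 1 k.+1]) (s j @^-1` A j).
  rewrite jointE -Ak iotaE; apply/seteqP; split=> w /=.
    by move=> [h hk] j /=; rewrite mem_cat inE => /orP[/h//|/eqP ->].
  move=> h; split=> [j /= jk|]; apply: h => /=; rewrite mem_cat ?jk//.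
  by rewrite inE eqxx orbT.
have iota_pos n j : j \in iota 1 n -> (0 < j)%N by rewrite mem_iota => /andP[].
rewrite jointSE jointE !sI ?iota_uniq//; try exact: iota_pos.
rewrite iotaE big_cat /= big_seq1 EFinM Ak fineK// fin_num_measure//.
exact: sd.
Qed.

End JointIndependence.

(** * Preconditioners and iterates *)

Section Loewner.
Context {R : realType} {d : nat}.
Implicit Types (S T : 'M[R]_d).

Lemma psdZ a S : 0 <= a -> psd S -> psd (a *: S).
Proof.
move=> a0 [Ssym Sge0]; split; first by rewrite linearZ /= Ssym.
by move=> v; rewrite -scalemxAl dotZr mulr_ge0.
Qed.

Lemma loewner_leZ a S T : 0 <= a -> loewner_le S T -> loewner_le (a *: S) (a *: T).
Proof. by rewrite /loewner_le -scalerBr; exact: psdZ. Qed.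

Lemma loewner_ge_psd (mu : R) S : 0 <= mu -> loewner_le mu%:M S -> psd S.
Proof.
move=> mu0 Smu; have [Ssym _] := Smu; split.
  by move: Ssym; rewrite linearB /= tr_scalar_mx => /addIr.
move=> v; apply: le_trans (loewner_le_dot v Smu).
by rewrite mul_scalar_mx dotZr mulr_ge0// dot_ge0.
Qed.

End Loewner.

(* The preconditioner of the previous step replaces the current one at the cost
   of [C (tr W - tr (alpha H))], which telescopes along the iterations. *)
Lemma preconditioned_step (R : realType) (d : nat) (M : set 'cV[R]_d) r
    (f : 'cV[R]_d -> R) (L G B nu alpha : R) (x g : 'cV[R]_d) (H W : 'M[R]_d) :
  embedded_submanifold M -> retraction M r ->
  (forall y, M y -> exists2 h : 'cV[R]_d -> R, differentiable h y &
     \forall z \near y, M z -> f z = h z) ->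
  (forall y eta, M y -> tangent M y eta ->
     `|Dmap (tangent M y) (fun v => f (r (y, v))) eta eta - Dmap M f y eta|
     <= L * norm2 eta ^+ 2) ->
  M x -> 0 <= L -> 0 < nu -> psd H -> loewner_le H nu%:M ->
  loewner_le (alpha *: H) W -> norm2 (rgrad M f x) <= G -> norm2 g <= B ->
  f (r (x, - alpha *: oproj (tangent M x) (H *m g))) +
    (G ^+ 2 + B ^+ 2) / 2 * \tr (alpha *: H) + dot (rgrad M f x) (W *m g) <=
  f x + (G ^+ 2 + B ^+ 2) / 2 * \tr W + L * nu ^+ 2 * B ^+ 2 / 2 * alpha ^+ 2.
Proof.
move=> Msub rr fl A4 Mx L0 nu0 Hpsd Hnu HW gfG gB; set C := (G ^+ 2 + B ^+ 2) / 2.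
have Tsub := tangent_subspace Msub Mx; move: gfG; set gf := rgrad M f x => gfG.
have Tgf : tangent M x gf by exact: rgrad_tangent.
have sqr_le (v : 'cV[R]_d) D : norm2 v <= D -> dot v v <= D ^+ 2.
  by move=> vD; rewrite -norm2_sqr lerXn2r// nnegrE ?norm2_ge0// (le_trans (norm2_ge0 v)).
set q := oproj (tangent M x) (H *m g).
have Tq : tangent M x (- alpha *: q) by apply: subspaceZ => //; exact: (oprojP _ Tsub).1.
(* The projection disappears from the linear term because the gradient is tangent, and it can only
   decrease the quadratic term. *)
have := retraction_descent Msub rr fl A4 Mx Tq.
rewrite -/gf !dotZr dotZl (oproj_dot _ Tsub Tgf).
have qB : dot q q <= nu ^+ 2 * B ^+ 2.
  apply: le_trans (oproj_sqr_le _ Tsub) _; apply: le_trans (psd_mulmx_sqr_le _ nu0 Hpsd Hnu) _.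
  by rewrite ler_wpM2l ?sqr_ge0// sqr_le.
have LqB : L * (- alpha * (- alpha * dot q q)) / 2 <=
    L * nu ^+ 2 * B ^+ 2 / 2 * alpha ^+ 2.
  have : L * alpha ^+ 2 * dot q q <= L * alpha ^+ 2 * (nu ^+ 2 * B ^+ 2).
    by rewrite ler_wpM2l// mulr_ge0// sqr_ge0.
  lra.
(* Replacing alpha H by W costs <grad f, S g>. Young's inequality and the trace bound limit it to tr
   S (G^2 + B^2) / 2, which is the origin of [C]. *)
pose S := W - alpha *: H.
have trS : \tr S = \tr W - \tr (alpha *: H) by rewrite linearB.
have := psd_young gf g HW; rewrite -/S.
have := psd_le_trace gf HW; have := psd_le_trace g HW; rewrite -/S.
have trS0 := psd_trace_ge0 HW; rewrite -/S in trS0.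
have := ler_wpM2l trS0 (sqr_le _ _ gfG); have := ler_wpM2l trS0 (sqr_le _ _ gB).
have -> : dot gf (S *m g) = dot gf (W *m g) - alpha * dot gf (H *m g).
  by rewrite mulmxBl dotBr -scalemxAl dotZr.
move=> hB hG h1 h2 /(le_trans (ler_norm _)) h3 h4.
have -> : C * \tr (alpha *: H) = C * \tr W - C * \tr S by rewrite trS; ring.
have -> : C * \tr S = (\tr S * G ^+ 2 + \tr S * B ^+ 2) / 2 by rewrite /C; ring.
move: (\tr S * G ^+ 2) (\tr S * B ^+ 2) (\tr S * dot gf gf) (\tr S * dot g g)
  hB hG h1 h2 h3 h4 LqB => *; lra.
Qed.

Lemma EX_dot (disp : measure_display) (Om : measurableType disp) (R : realType)
    (P : probability Om R) (d : nat) (T : finType) (Y : Om -> T)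
    (a : 'cV[R]_d) (Z : Om -> 'cV[R]_d) :
  discrete_rv Y -> determined_by Y Z ->
  EX P (fun w => dot a (Z w)) = dot a (vexpectation P Z).
Proof.
move=> Yd YZ; have YZi i : determined_by Y (fun w => Z w i 0).
  by move=> w w' /YZ ->.
rewrite [RHS]dotE.
have -> : (fun w => dot a (Z w)) = (fun w => \sum_i a i 0 * Z w i 0).
  by apply/funext => w; rewrite dotE.
rewrite (EX_sum P Yd); last by move=> i w w' /YZ ->.
by apply: eq_bigr => i _; rewrite (EXZ _ _ Yd (YZi i)) mxE.
Qed.

Section Iterates.
Context {R : realType} {d N : nat} {Om : Type}.
Variables (M : set 'cV[R]_d) (fi : 'I_N -> 'cV[R]_d -> R).
Variables (b : nat -> nat) (s : forall k, Om -> (b k).-tuple 'I_N).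
Arguments s : clear implicits.
Variable phi : forall k, k.-tuple ('cV[R]_d * 'cV[R]_d) -> 'cV[R]_d.
Variable psi : forall k, k.-tuple ('cV[R]_d * 'cV[R]_d) -> 'M[R]_d.
Variables (x : nat -> Om -> 'cV[R]_d) (x1 : 'cV[R]_d).
Variables (r : 'cV[R]_d * 'cV[R]_d -> 'cV[R]_d) (alpha : nat -> R).
Hypothesis x_gen : generated M fi s x phi psi x1 r alpha.

Lemma generated_mem : embedded_submanifold M -> retraction M r -> M x1 ->
  forall k w, (0 < k)%N -> M (x k w).
Proof.
move=> Msub [_ rM _ _] Mx1; case: x_gen => x1E xE.
elim=> // -[_ w _|k IH w _]; first by rewrite x1E.
rewrite xE//; apply: rM; split => /=; first exact: IH.
have Tsub := tangent_subspace Msub (IH w isT).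
by apply: subspaceZ => //; exact: (oprojP _ Tsub).1.
Qed.

Let T k : finType := (b k).-tuple 'I_N.
Let joint_s := joint (T := T) s.

Lemma history_eq k w w' : (forall j, (j < k)%N -> x j.+1 w = x j.+1 w') ->
  joint_s k w = joint_s k w' ->
  history M fi s x k w = history M fi s x k w'.
Proof.
move=> xw /jointP sw; apply: eq_from_tnth => j; rewrite !tnth_mktuple.
by rewrite /batch_grad xw// sw//= ltn_ord.
Qed.

(** The iterate of index k + 1 uses only the samples s_1, .., s_k, which is what makes it
    independent of s_{k+1}. All earlier iterates are carried along in the induction, since the
    update reads the whole history. *)
Lemma iterate_determined k j : (j <= k)%N -> determined_by (joint_s k) (x j.+1).
Proof.
move=> jk w w' sw; case: x_gen => x1E xE.
suff xw n : (n <= k)%N -> forall i, (i <= n)%N -> x i.+1 w = x i.+1 w'.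
  exact: (xw j).
elim: n => [_ [|//] _|n IH nk i]; first by rewrite !x1E.
rewrite leq_eqVlt ltnS => /predU1P[->|]; last exact: IH (ltnW nk) i.
have IHn := IH (ltnW nk).
rewrite (xE n.+1 w)// (xE n.+1 w')// /precond /momentum (IHn n)//.
by rewrite (@history_eq n.+1 w w')//; exact: joint_le sw.
Qed.

Lemma history_determined k : determined_by (joint_s k) (history M fi s x k).
Proof.
move=> w w' sw; apply: history_eq => // j jk.
by apply: (iterate_determined (ltnW jk)).
Qed.

Lemma batch_grad_determined k : determined_by (joint_s k.+1) (batch_grad M fi s x k.+1).
Proof.
move=> w w' sw; have sk := (jointP s k.+1 w w').1 sw k.+1 (leqnn _).
by rewrite /batch_grad (iterate_determined (leqnSn k) sw) sk.
Qed.

End Iterates.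

(** * Averaging over the current sample *)

Section ConditionalExpectation.
Context {disp : measure_display} {Om : measurableType disp} {R : realType}.
Variable P : probability Om R.
Context {d : nat}.

Lemma vexpectation_mean (T : finType) (Y : Om -> T) (n : nat)
    (Z : 'I_n -> Om -> 'cV[R]_d) (m : 'cV[R]_d) :
  discrete_rv Y -> (forall i, determined_by Y (Z i)) -> (0 < n)%N ->
  (forall i, vexpectation P (Z i) = m) ->
  vexpectation P (fun w => n%:R^-1 *: \sum_(i < n) Z i w) = m.
Proof.
move=> Yd YZ n0 Zm; apply/matrixP => j k; rewrite ord1 mxE -[LHS]/(EX P _).
have YZj i : determined_by Y (fun w => Z i w j 0) by move=> w w' /YZ ->.
have -> : (fun w => (n%:R^-1 *: \sum_(i < n) Z i w) j 0) =
    (fun w => n%:R^-1 * \sum_(i < n) Z i w j 0).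
  by apply/funext => w; rewrite mxE summxE.
rewrite (EXZ _ _ Yd); last first.
  by move=> w w' ww'; apply: eq_bigr => i _; exact: YZj.
rewrite (EX_sum P Yd)//.
have -> : \sum_(i < n) EX P (fun w => Z i w j 0) = \sum_(i < n) m j 0.
  by apply: eq_bigr => i _; rewrite -(Zm i) mxE.
by rewrite sumr_const card_ord -(mulr_natl (m j 0)) mulKf// pnatr_eq0 -lt0n.
Qed.

(** With the past [X] frozen, [A] is constant and leaves the inner expectation over the current
    sample [Y], whose value is [m] almost surely. *)
Lemma EX_conditional_dot (T T' : finType) (X : Om -> T) (Y : Om -> T')
    (A m : Om -> 'cV[R]_d) (Z : Om -> T' -> 'cV[R]_d) :
  discrete_rv X -> discrete_rv Y -> independent_rv P X Y ->
  determined_by X A -> determined_by X m -> determined_by X Z ->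
  {ae P, forall w, vexpectation P (fun w' => Z w (Y w')) = m w} ->
  EX P (fun w => dot (A w) (Z w (Y w))) = EX P (fun w => dot (A w) (m w)).
Proof.
move=> Xd Yd XY XA Xm XZ Zm.
have [F AE] := determined_byP XA; have [G ZE] := determined_byP XZ.
transitivity (EX P (fun w => dot (F (X w)) (G (X w) (Y w)))); first by rewrite AE ZE.
rewrite (EX_independent (fun a t => dot (F a) (G a t)) Xd Yd XY).
have innerE w : EX P (fun w' => dot (F (X w)) (G (X w) (Y w'))) =
    dot (A w) (vexpectation P (fun w' => Z w (Y w'))).
  by rewrite (EX_dot _ _ Yd) ?AE ?ZE// => w1 w2 ->.
rewrite (_ : (fun w => EX P (fun w' => dot (F (X w)) (G (X w) (Y w')))) =
    (fun w => dot (A w) (vexpectation P (fun w' => Z w (Y w'))))); last exact/funext.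
have Xl : determined_by X (fun w => dot (A w) (vexpectation P (fun w' => Z w (Y w')))).
  by move=> w w' ww'; rewrite (XA _ _ ww') (XZ _ _ ww').
have Xr : determined_by X (fun w => dot (A w) (m w)).
  by move=> w w' ww'; rewrite (XA _ _ ww') (Xm _ _ ww').
apply/eqP; rewrite eq_le !(EX_ae_le Xd)//.
  by apply: filterS Zm => w ->.
by apply: filterS Zm => w ->.
Qed.

End ConditionalExpectation.

(** * The one-step recursion and its summation *)

Theorem theorem3p4 (R : realType) (d N : nat)
  (* the problem *)
  (M : set 'cV[R]_d) (M_sub : embedded_submanifold M)
  (fi : 'I_N -> 'cV[R]_d -> R) (fi_smooth : forall i, smooth_on M (fi i))
  (* the sampling *)
  (disp : measure_display) (Om : measurableType disp) (P : probability Om R)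
  (b : nat -> nat) (b_bounds : forall k, (0 < k)%N -> (0 < b k <= N)%N)
  (s : forall k, Om -> (b k).-tuple 'I_N)
  (s_rv : forall k, (0 < k)%N -> discrete_rv (s k))
  (s_indep : mutually_independent P [set k | (0 < k)%N] s)
  (* the scheme *)
  (x1 : 'cV[R]_d) (x1M : M x1)
  (r : 'cV[R]_d * 'cV[R]_d -> 'cV[R]_d) (r_retr : retraction M r)
  (alpha : nat -> R) (alpha_gt0 : forall k, (0 < k)%N -> 0 < alpha k)
  (phi : forall k, k.-tuple ('cV[R]_d * 'cV[R]_d) -> 'cV[R]_d)
  (psi : forall k, k.-tuple ('cV[R]_d * 'cV[R]_d) -> 'M[R]_d)
  (psi_pos : forall k (t : k.-tuple ('cV[R]_d * 'cV[R]_d)), (0 < k)%N ->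
    (forall j, tangent_bundle M (tnth t j)) ->
    is_diag_mx (psi k t) /\ posdef (psi k t))
  (x : nat -> Om -> 'cV[R]_d)
  (x_gen : generated M fi s x phi psi x1 r alpha)
  (s_indep_x : forall k, (0 < k)%N ->
    independent_of P (s k) (sigma_of [set j | (0 < j <= k)%N] x))
  (sigma G B L fstar mu nu : R) :
  let f := mean_fun fi in
  let g := batch_grad M fi s x in
  let m := momentum M fi s x phi in
  let Hinv := fun k w => invmx (precond M fi s x psi k w) in
  (* (A1); E_k integrates over s_k with x_k(w) held fixed *)
  (forall k (i : 'I_(b k)), (0 < k)%N -> {ae P, forall w,
     vexpectation P (fun w' => rgrad M (fi (tnth (s k w') i)) (x k w)) =
     rgrad M f (x k w)}) ->
  (* (A2) *)
  0 < sigma ^+ 2 ->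
  (forall k (i : 'I_(b k)), (0 < k)%N -> {ae P, forall w,
     ('E_P[fun w' => (norm2 (rgrad M (fi (tnth (s k w') i)) (x k w)
                             - rgrad M f (x k w)) ^+ 2)%R]
      <= (sigma ^+ 2)%:E)%E}) ->
  (* (A3) *)
  0 < G -> 0 < B ->
  (forall k, (0 < k)%N -> {ae P, forall w,
     norm2 (rgrad M f (x k w)) <= G /\ norm2 (g k w) <= B}) ->
  (* (A4) *)
  0 < L ->
  (forall y eta, M y -> tangent M y eta ->
     `|Dmap (tangent M y) (fun v => f (r (y, v))) eta eta - Dmap M f y eta|
     <= L * norm2 eta ^+ 2) ->
  (* (A5) *)
  (forall y, M y -> fstar <= f y) ->
  (* step sizes and preconditioners *)
  (forall k, (0 < k)%N -> alpha k.+1 <= alpha k) ->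
  (forall k, (0 < k)%N -> {ae P, forall w, m k w = g k w}) ->
  (forall k, (0 < k)%N -> {ae P, forall w,
     loewner_le (alpha k.+1 *: Hinv k.+1 w) (alpha k *: Hinv k w)}) ->
  0 < mu -> 0 < nu ->
  (forall k, (0 < k)%N -> {ae P, forall w,
     loewner_le mu%:M (Hinv k w) /\ loewner_le (Hinv k w) nu%:M}) ->
  exists C1 C2 : R, 0 < C1 /\ 0 < C2 /\ forall K : nat,
    (\sum_(1 <= k < K.+1)
       (alpha k * (mu - L * alpha k * nu ^+ 2 / 2))%:E *
       'E_P[fun w => (norm2 (rgrad M f (x k w)) ^+ 2)%R]
     <= (C1 + C2 * \sum_(1 <= k < K.+1) (alpha k ^+ 2 / (b k)%:R))%:E)%E.
Proof.
move=> f g m Hinv A1 _ _ G_gt0 B_gt0 A3 L_gt0 A4 A5 _ mg Hmon mu_gt0 nu_gt0 Hbd.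
have N_gt0 : (0 < N)%N by have /andP[b0 /(leq_trans b0)] := b_bounds 1%N isT.
have xM k w : (0 < k)%N -> M (x k w) by exact: (generated_mem x_gen).
have fl y : M y -> exists2 h : 'cV[R]_d -> R, differentiable h y &
    \forall z \near y, M z -> f z = h z by exact: mean_fun_local.
pose T k : finType := (b k).-tuple 'I_N.
pose J k := joint (T := T) s k.
have Jd k : discrete_rv (J k) by exact: discrete_joint.
pose gf k w := rgrad M f (x k w).
pose W k w : 'M[R]_d := if k is 0 then (alpha 1%N * nu)%:M else alpha k *: Hinv k w.
pose C := (G ^+ 2 + B ^+ 2) / 2; pose c := L * nu ^+ 2 * B ^+ 2 / 2.
have C_ge0 : 0 <= C by rewrite divr_ge0// addr_ge0// sqr_ge0.
have c_gt0 : 0 < c by rewrite divr_gt0// !mulr_gt0// exprn_gt0.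
have Jx k j : (j <= k)%N -> determined_by (J k) (x j.+1).
  by move=> jk; exact: (iterate_determined x_gen).
have JHinv k : determined_by (J k) (Hinv k).
  by move=> w w' ww'; rewrite /Hinv /precond (history_determined x_gen ww').
have JW j k : (j <= k)%N -> determined_by (J k) (W j).
  by case: j => // j jk w w' /(joint_le jk)/JHinv; rewrite /W => ->.
have Jgf k : determined_by (J k) (gf k.+1).
  by move=> w w' ww'; rewrite /gf (Jx _ _ (leqnn k) _ _ ww').
have Jg k : determined_by (J k.+1) (g k.+1).
  by move=> w w' ww'; rewrite /g (batch_grad_determined x_gen ww').
have Hfacts k : {ae P, forall w, [/\ psd (Hinv k.+1 w), loewner_le mu%:M (Hinv k.+1 w),
    loewner_le (Hinv k.+1 w) nu%:M & loewner_le (W k.+1 w) (W k w)]}.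
  have Wmon : {ae P, forall w, loewner_le (W k.+1 w) (W k w)}.
    (* At [k = 0] the comparison is the upper bound nu I on the first preconditioner, scaled by
       alpha_1. *)
    case: k => [|k]; last exact: Hmon.
    apply: filterS (Hbd 1%N isT) => w [_ Hnu].
    have -> : W 0%N w = alpha 1%N *: nu%:M by rewrite scale_scalar_mx.
    by apply: loewner_leZ => //; exact/ltW/alpha_gt0.
  apply: filterS2 Wmon (Hbd k.+1 isT) => w WW [Hmu Hnu]; split=> //.
  exact: loewner_ge_psd (ltW mu_gt0) Hmu.
(* The potential that decreases up to the second-order error; both summands depend on s_1, .., s_k
   only. *)
pose v k := EX P (fun w => f (x k.+1 w) + C * \tr (W k w)).
pose e k := EX P (fun w => norm2 (gf k w) ^+ 2).
have Jv k : determined_by (J k) (fun w => f (x k.+1 w) + C * \tr (W k w)).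
  by move=> w w' ww'; rewrite (Jx _ _ (leqnn k) _ _ ww') (JW _ _ (leqnn k) _ _ ww').
have Jdot k : determined_by (J k.+1) (fun w => dot (gf k.+1 w) (W k w *m g k.+1 w)).
  move=> w w' ww'; have ww'k := joint_le (leqnSn k) ww'.
  by rewrite (Jgf _ _ _ ww'k) (JW _ _ (leqnSn k) _ _ ww') (Jg _ _ _ ww').
have unbiased k : EX P (fun w => dot (gf k.+1 w) (W k w *m g k.+1 w)) =
    EX P (fun w => dot (gf k.+1 w) (W k w *m gf k.+1 w)).
  pose Z w (t : T k.+1) : 'cV[R]_d :=
    (b k.+1)%:R^-1 *: \sum_(i < b k.+1) rgrad M (fi (tnth t i)) (x k.+1 w).
  have b_gt0 : (0 < b k.+1)%N by have /andP[] := b_bounds k.+1 isT.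
  (* [W k] is moved to the left factor as a transpose, so that everything multiplying the batch
     gradient is a function of the past. *)
  have JA : determined_by (J k) (fun w => (W k w)^T *m gf k.+1 w).
    by move=> w w' ww'; rewrite (Jgf _ _ _ ww') (JW _ _ (leqnn k) _ _ ww').
  have JZ : determined_by (J k) Z.
    by move=> w w' ww'; apply/funext => t; rewrite /Z (Jx _ _ (leqnn k) _ _ ww').
  have sd : discrete_rv (s k.+1 : Om -> T k.+1) by exact: s_rv.
  have A1k : {ae P, forall w,
      vexpectation P (fun w' => Z w (s k.+1 w')) = gf k.+1 w}.
    have : {ae P, forall w, forall i, vexpectation P
        (fun w' => rgrad M (fi (tnth (s k.+1 w') i)) (x k.+1 w)) = gf k.+1 w}.
      by apply: filter_forall => i; exact: A1.
    apply: filterS => w A1w.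
    apply: (vexpectation_mean (Y := s k.+1 : Om -> T k.+1) (P := P)
      (Z := fun i w' => rgrad M (fi (tnth (s k.+1 w') i)) (x k.+1 w)) sd) => //.
    by move=> i w1 w2 ->.
  have := EX_conditional_dot (Jd k) sd (joint_independent s_indep s_rv) JA (Jgf k) JZ A1k.
  rewrite (_ : (fun w => dot _ (Z w _)) =
    (fun w => dot (gf k.+1 w) (W k w *m g k.+1 w))); last first.
    by apply/funext => w; rewrite dot_mulmxr.
  by move=> ->; congr (EX P _); apply/funext => w; rewrite dot_mulmxr.
(* The bound W_k >= W_{k+1} >= alpha_{k+1} mu I passes through a matrix depending on s_{k+1}, but
   the two random variables finally compared are functions of the past. *)
have dot_ge k : alpha k.+1 * mu * e k.+1 <=
    EX P (fun w => dot (gf k.+1 w) (W k w *m gf k.+1 w)).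
  have Jn : determined_by (J k) (fun w => norm2 (gf k.+1 w) ^+ 2).
    by move=> w w' /Jgf ->.
  rewrite -(EXZ _ _ (Jd k) Jn); apply: (EX_ae_le (Jd k)).
  - by move=> w w' /Jgf ->.
  - by move=> w w' ww'; rewrite (Jgf _ _ _ ww') (JW _ _ (leqnn k) _ _ ww').
  apply: filterS (Hfacts k) => w [_ Hmu _ WW].
  apply: le_trans (loewner_le_dot (gf k.+1 w) WW).
  rewrite -scalemxAl dotZr -mulrA ler_wpM2l//; first exact/ltW/alpha_gt0.
  by have := loewner_le_dot (gf k.+1 w) Hmu; rewrite mul_scalar_mx dotZr norm2_sqr.
have step k : v k.+1 + alpha k.+1 * mu * e k.+1 <= v k + c * alpha k.+1 ^+ 2.
  have : v k.+1 + EX P (fun w => dot (gf k.+1 w) (W k w *m g k.+1 w)) <=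
      v k + EX P (fun=> c * alpha k.+1 ^+ 2).
    have Jc : determined_by (J k) (fun=> c * alpha k.+1 ^+ 2) by [].
    rewrite -(EXD P (Jd k.+1) (Jv k.+1) (Jdot k)) -(EXD P (Jd k) (Jv k) Jc).
    apply: (EX_ae_le (Jd k.+1)).
    - by move=> w w' ww'; rewrite (Jv _ _ _ ww') (Jdot _ _ _ ww').
    - by move=> w w' /(joint_le (leqnSn k))/Jv ->.
    apply: filterS3 (Hfacts k) (A3 k.+1 isT) (mg k.+1 isT).
    move=> w [Hpsd _ Hnu WW] [gfG gB] mgw.
    have [_ ->//] := x_gen; rewrite -/(m k.+1 w) -/(Hinv k.+1 w) mgw.
    exact: (preconditioned_step M_sub r_retr fl A4 (xM k.+1 w isT) (ltW L_gt0) nu_gt0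
      Hpsd Hnu WW gfG gB).
  rewrite EX_cst unbiased; apply: le_trans; by rewrite lerD2l.
have vK K : fstar <= v K.
  rewrite -(EX_cst P fstar); apply: (EX_ae_le (Jd K) _ (Jv K)) => //.
  have trW : {ae P, forall w, 0 <= \tr (W K w)}.
    case: K => [|K].
      apply: nearW => w; rewrite mxtrace_scalar mulrn_wge0// ltW// mulr_gt0//.
      exact: alpha_gt0.
    apply: filterS (Hfacts K) => w [Hpsd _ _ _]; rewrite mxtraceZ.
    by rewrite mulr_ge0// ?psd_trace_ge0// ltW// alpha_gt0.
  apply: filterS trW => w tr0; rewrite -[leLHS]addr0 lerD ?(mulr_ge0 C_ge0)//.
  by apply: A5; exact: xM.
have telescope K : \sum_(1 <= k < K.+1) alpha k * mu * e k <=
    v 0%N - v K + c * \sum_(1 <= k < K.+1) alpha k ^+ 2.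
  elim: K => [|K IH]; first by rewrite !big_geq// subrr mulr0 addr0.
  rewrite big_nat_recr//= [X in c * X]big_nat_recr//=.
  by have := step K; lra.
(* The bound [vK] at 0 only gives [v 0%N - fstar >= 0]; adding 1 makes the first constant positive.
   The factor [N] pays for the division by [b k]. *)
exists (v 0%N - fstar + 1), (c * N%:R); split; first by rewrite ltr_wpDl// subr_ge0.
split; first by rewrite mulr_gt0// ltr0n.
move=> K.
have eE k : (0 < k)%N -> ('E_P[fun w => (norm2 (rgrad M f (x k w)) ^+ 2)%R] = (e k)%:E)%E.
  case: k => // k _; rewrite (expectation_EX P (Jd k))// => w w' ww'.
  by rewrite (Jx _ _ (leqnn k) _ _ ww').
have e_ge0 k : 0 <= e k by rewrite fine_ge0// expectation_ge0// => w; exact: sqr_ge0.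
rewrite (_ : (\sum_(1 <= k < K.+1) _)%E =
    (\sum_(1 <= k < K.+1) alpha k * (mu - L * alpha k * nu ^+ 2 / 2) * e k)%:E); last first.
  by rewrite -sumEFin big_nat [RHS]big_nat; apply: eq_bigr => k /andP[k0 _]; rewrite eE.
rewrite lee_fin.
(* The telescoped estimate has the larger weight alpha_k mu, and [e k] is nonnegative, so the stated
   weight may take its place. *)
have le1 : \sum_(1 <= k < K.+1) alpha k * (mu - L * alpha k * nu ^+ 2 / 2) * e k <=
    \sum_(1 <= k < K.+1) alpha k * mu * e k.
  rewrite big_nat [leRHS]big_nat; apply: ler_sum => k /andP[k0 _].
  rewrite ler_wpM2r// ler_wpM2l ?ltW ?alpha_gt0// ltrBlDr ltrDl.
  by rewrite divr_gt0// !mulr_gt0// ?alpha_gt0// exprn_gt0.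
have le2 : \sum_(1 <= k < K.+1) alpha k ^+ 2 <=
    N%:R * \sum_(1 <= k < K.+1) (alpha k ^+ 2 / (b k)%:R).
  rewrite mulr_sumr big_nat [leRHS]big_nat; apply: ler_sum => k /andP[k0 _].
  have /andP[b0 bN] := b_bounds k k0.
  rewrite mulrCA ler_peMr ?sqr_ge0// ler_pdivlMr ?ltr0n// mul1r ler_nat//.
have := ler_wpM2l (ltW c_gt0) le2; have := telescope K; have := vK K.
by rewrite mulrA; lra.
Qed.
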